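(* Let $P=G(K_{\mathbb X})$ and $Q=H(K_{\mathbb Y})$ be LISC cones belonging to $\mathcal C(\mathbb V)$. Let $(x^0,y^0)\in\Delta_{\mathbb X}\times\Delta_{\mathbb Y}$, $\beta>0$, $0<\alpha<1$, $0<\rho<1$, $\mu_1,\mu_2\ge 0$, and let $\{(x^k,y^k)\}$ be the sequence generated by the Sequential Regularized Partial Linearization algorithm described in the context with these data. Then every accumulation point $(\bar x,\bar y)$ of $\{(x^k,y^k)\}$ is a stationary point of the fractional program $$\min\ \Phi(x,y):=\frac{\langle Gx,Hy\rangle}{\|Gx\|\,\|Hy\|}\quad\text{s.t. } x\in K_{\mathbb X},\ \langle e_{\mathbb X},x\rangle=1,\ y\in K_{\mathbb Y},\ \langle e_{\mathbb Y},y\rangle=1 .$$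
   Context: A Euclidean Jordan algebra (EJA) is a finite-dimensional real inner product space $\mathbb X$ with a commutative bilinear product $\circ$ satisfying the Jordan identity $x\circ(x^2\circ y)=x^2\circ(x\circ y)$ (where $x^2=x\circ x$), with $\langle x\circ y,z\rangle=\langle y,x\circ z\rangle$ for all $x,y,z$, and with a unit element $e_{\mathbb X}$. Its symmetric cone is $K_{\mathbb X}=\{x\circ x: x\in\mathbb X\}$ (it is self-dual). An idempotent is $c$ with $c\circ c=c$; it is primitive if nonzero and not the sum of two nonzero idempotents. All EJAs are assumed scalarizable: there is $\kappa>0$ with $\langle x,y\rangle=\kappa\,\mathrm{tr}(x\circ y)$ for all $x,y$, where $\mathrm{tr}$ is the sum of the eigenvalues in the spectral decomposition. The spectraplex is $\Delta_{\mathbb X}=\{x\in K_{\mathbb X}:\langle e_{\mathbb X},x\rangle=1\}$; $\Delta_{\mathbb Y}$ is defined likewise for an EJA $\mathbb Y$ with unit element $e_{\mathbb Y}$. $\mathbb V$ is a (finite-dimensional) Euclidean space; $\mathcal C(\mathbb V)$ is the set of closed convex cones $K\subseteq\mathbb V$ with $K\ne\{0\}$, $K\ne\mathbb V$. A closed convex cone $P\subseteq \mathbb V$ is a LISC cone, represented as $P=G(K_{\mathbb X})$, if $\mathbb X$ is an EJA and $G:\mathbb X\to\mathbb V$ is linear with $G(K_{\mathbb X})=P$, $G(c)\neq0$ for every primitive idempotent $c\in\mathbb X$, and $P\cap(-P)=\{0\}$. Likewise $Q=H(K_{\mathbb Y})$ with $H:\mathbb Y\to\mathbb V$. Then $Gx\ne0$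 for $x\in K_{\mathbb X}\setminus\{0\}$ and $Hy\neq 0$ for $y\in K_{\mathbb Y}\setminus\{0\}$. Stationarity: $(\bar x,\bar y)$ is a stationary point of $\min \Psi(x,y)$ s.t. $x\in K_{\mathbb X},\ \phi_1(x)=0,\ y\in K_{\mathbb Y},\ \phi_2(y)=0$ if there exist $\gamma_1,\gamma_2\in\mathbb R$ such that $\bar x\in K_{\mathbb X}$, $\nabla_x\Psi(\bar x,\bar y)+\gamma_1\nabla\phi_1(\bar x)\in K_{\mathbb X}^*$, these two are orthogonal; $\bar y\in K_{\mathbb Y}$, $\nabla_y\Psi(\bar x,\bar y)+\gamma_2\nabla\phi_2(\bar y)\in K_{\mathbb Y}^*$, these two are orthogonal; and $\phi_1(\bar x)=0=\phi_2(\bar y)$. Here $K^*$ is the dual cone $\{\zeta:\langle\zeta,u\rangle\ge0\ \forall u\in K\}$. For the fractional program, $\Psi=\Phi$, $\phi_1(x)=\langle e_{\mathbb X},x\rangle-1$, $\phi_2(y)=\langle e_{\mathbb Y},y\rangle-1$. Algorithm (iteration $k=0,1,\dots$, given $(x^k,y^k)$): Step 1: $\delta_k:=\frac{\langle Gx^k,Hy^k\rangle}{\|Gx^k\|\|Hy^k\|}$. Step 2: with $L_1^k(x):=\langle Gx,\,Hy^k-\delta_k\|Gx^k\|^{-1}\|Hy^k\|\,Gx^k\rangle$ and $L_2^k(y):=\langle Hy,\,Gx^k-\delta_k\|Gx^k\|\|Hy^k\|^{-1}Hy^k\rangle$, compute a minimizer $\tilde x^k$ of $L_1^k(x)+\frac{\mu_1}{2}\|x-x^k\|^2$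 over $\Delta_{\mathbb X}$, and a minimizer $\tilde y^k$ of $L_2^k(y)+\frac{\mu_2}{2}\|y-y^k\|^2$ over $\Delta_{\mathbb Y}$. Put $d_1^k:=\tilde x^k-x^k$, $d_2^k:=\tilde y^k-y^k$. Step 3: if $L_1^k(d_1^k)=0$ and $L_2^k(d_2^k)=0$, terminate. Otherwise let $t_k:=\beta\rho^{\ell_k}$ where $\ell_k$ is the smallest nonnegative integer $\ell$ such that, with $t=\beta\rho^{\ell}$, $$\Phi(x^k+t d_1^k,y^k+t d_2^k)\le\Phi(x^k,y^k)+\alpha t\,\frac{L_1^k(d_1^k)+L_2^k(d_2^k)}{\|Gx^k\|\|Hy^k\|},$$ set $(x^{k+1},y^{k+1}):=(x^k,y^k)+t_k(d_1^k,d_2^k)$, and return to Step 1.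
   Formalization: For β > 1 the theorem additionally assumes that all iterates (x^k, y^k) stay in Δ_X × Δ_Y; without this the claim fails, since steps longer than 1 can leave the feasible set and cycle between non-stationary points. For 0 < β ≤ 1 nothing is added. *)

(* Defs.v *)
From HB Require Import structures.
From mathcomp Require Import all_boot all_order all_algebra.
From mathcomp Require Import all_classical all_reals all_analysis.
Import Order.TTheory GRing.Theory Num.Theory.
Import numFieldNormedType.Exports.

Set Implicit Arguments.
Unset Strict Implicit.
Unset Printing Implicit Defensive.

Local Open Scope classical_set_scope.
Local Open Scope ring_scope.

(* A Euclidean space: a finite-dimensional normed space whose norm (hence whose
   topology) is the one induced by an inner product. *)
HB.mixin Record isEuclidean (R : realType) V
    of Vector R V & NormedModule R V := {
  inner : V -> V -> R;
  innerC : forall u v, inner u v = inner v u;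
  inner_linearl : forall a u v w,
    inner (a *: u + v) w = a * inner u w + inner v w;
  inner_norm : forall u, inner u u = `|u| ^+ 2
}.

#[short(type="euclideanType")]
HB.structure Definition Euclidean (R : realType) :=
  {V of isEuclidean R V & Vector R V & NormedModule R V}.

HB.mixin Record isEuclideanJordan (R : realType) X of Euclidean R X := {
  jmul : X -> X -> X;
  jone : X;
  jmulC : forall x y, jmul x y = jmul y x;
  jmul_linearl : forall a x y z,
    jmul (a *: x + y) z = a *: jmul x z + jmul y z;
  jordan_identity : forall x y,
    jmul x (jmul (jmul x x) y) = jmul (jmul x x) (jmul x y);
  inner_jmul : forall x y z : X, inner (jmul x y) z = inner y (jmul x z);
  jmul1x : forall x, jmul jone x = x
}.

#[short(type="ejaType")]
HB.structure Definition EuclideanJordan (R : realType) :=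
  {X of isEuclideanJordan R X & Euclidean R X}.

Section EJA.
Context {R : realType} {X : ejaType R}.
Implicit Types x y c : X.

Definition symmetric_cone : set X := [set x | exists z, x = jmul z z].

Definition jidempotent c : Prop := jmul c c = c.

Definition primitive_idempotent c : Prop :=
  [/\ jidempotent c, c <> 0 &
      ~ exists a b : X,
          [/\ jidempotent a, a <> 0, jidempotent b, b <> 0 & c = a + b]].

Definition jordan_frame (r : nat) (c : 'I_r -> X) : Prop :=
  [/\ forall i, primitive_idempotent (c i),
      forall i j, i != j -> jmul (c i) (c j) = 0 &
      \sum_(i < r) c i = jone].

Definition spectral_decomposition (r : nat) (c : 'I_r -> X) (lam : 'I_r -> R)
    x : Prop :=
  jordan_frame c /\ x = \sum_(i < r) lam i *: c i.

(* By the spectral theorem the set below is always a singleton. *)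
Definition jtr x : R :=
  xget 0 [set t | exists r (c : 'I_r -> X) (lam : 'I_r -> R),
                    spectral_decomposition c lam x /\ t = \sum_(i < r) lam i].

Definition spectraplex : set X :=
  [set x | symmetric_cone x /\ inner jone x = 1].

End EJA.

Arguments symmetric_cone {R} X.
Arguments spectraplex {R} X.

Definition scalarizable (R : realType) (X : ejaType R) : Prop :=
  exists2 kappa : R, 0 < kappa &
    forall x y : X, inner x y = kappa * jtr (jmul x y).

Section Cones.
Context {R : realType} {V : euclideanType R}.

Definition convex_cone (K : set V) : Prop :=
  K !=set0 /\
  forall (a b : R) (u v : V), 0 <= a -> 0 <= b -> K u -> K v ->
    K (a *: u + b *: v).

Definition closed_convex_cone (K : set V) : Prop := closed K /\ convex_cone K.

Definition nontrivial_cone (K : set V) : Prop :=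
  [/\ closed_convex_cone K, K <> [set 0] & K <> setT].

Definition dual_cone (K : set V) : set V :=
  [set z | forall u, K u -> 0 <= inner z u].

Definition lisc_representation (X : ejaType R) (G : {linear X -> V})
    (P : set V) : Prop :=
  [/\ closed_convex_cone P,
      G @` symmetric_cone X = P,
      forall c : X, primitive_idempotent c -> G c <> 0 &
      P `&` [set - u | u in P] = [set 0]].

Definition is_gradient (f : V -> R) (u g : V) : Prop :=
  differentiable f u /\ forall h, 'd f u h = inner g h.

End Cones.

Definition stationary_point (R : realType) (X Y : ejaType R)
    (Psi : X -> Y -> R) (phi1 : X -> R) (phi2 : Y -> R) (x : X) (y : Y) : Prop :=
  exists (gamma1 gamma2 : R) (gx gphi1 : X) (gy gphi2 : Y),
    [/\ is_gradient (fun u => Psi u y) x gx, is_gradient phi1 x gphi1,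
        is_gradient (fun v => Psi x v) y gy & is_gradient phi2 y gphi2] /\
    [/\ symmetric_cone X x,
        dual_cone (symmetric_cone X) (gx + gamma1 *: gphi1) &
        inner x (gx + gamma1 *: gphi1) = 0] /\
    [/\ symmetric_cone Y y,
        dual_cone (symmetric_cone Y) (gy + gamma2 *: gphi2) &
        inner y (gy + gamma2 *: gphi2) = 0] /\
    phi1 x = 0 /\ phi2 y = 0.

Definition minimizer (R : realType) (T : Type) (f : T -> R) (D : set T)
    (x : T) : Prop :=
  D x /\ forall u, D u -> f x <= f u.

Section Algorithm.
Context {R : realType} {V : euclideanType R} {X Y : ejaType R}.
Variables (G : {linear X -> V}) (H : {linear Y -> V}).

(* Division by 0 yields 0, so Phi is meaningful only where G x and H y are
   nonzero; this is so for nonzero x, y in the symmetric cones whenever G and H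
   represent LISC cones. *)
Definition Phi (x : X) (y : Y) : R :=
  inner (G x) (H y) / (`|G x| * `|H y|).

Definition fp_stationary (x : X) (y : Y) : Prop :=
  stationary_point Phi
    (fun u => inner jone u - 1) (fun v => inner jone v - 1) x y.

Section Step.
Variables (alpha beta rho mu1 mu2 : R) (xk : X) (yk : Y).

Definition delta : R := inner (G xk) (H yk) / (`|G xk| * `|H yk|).

Definition L1 (x : X) : R :=
  inner (G x) (H yk - (delta * `|G xk|^-1 * `|H yk|) *: G xk).

Definition L2 (y : Y) : R :=
  inner (H y) (G xk - (delta * `|G xk| * `|H yk|^-1) *: H yk).

Definition armijo (d1 : X) (d2 : Y) (t : R) : Prop :=
  Phi (xk + t *: d1) (yk + t *: d2) <=
    Phi xk yk + alpha * t * ((L1 d1 + L2 d2) / (`|G xk| * `|H yk|)).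

(* One complete iteration, i.e. one that does not stop at the termination
   test, leading from (xk, yk) to (xk1, yk1). *)
Definition srpl_step (xk1 : X) (yk1 : Y) : Prop :=
  exists (xt : X) (yt : Y) (l : nat),
    let d1 := xt - xk in let d2 := yt - yk in
    let t := beta * rho ^+ l in
    [/\ minimizer (fun x => L1 x + mu1 / 2 * `|x - xk| ^+ 2)
          (spectraplex X) xt,
        minimizer (fun y => L2 y + mu2 / 2 * `|y - yk| ^+ 2)
          (spectraplex Y) yt &
        ~ (L1 d1 = 0 /\ L2 d2 = 0)] /\
    [/\ armijo d1 d2 t,
        forall l' : nat, (l' < l)%N -> ~ armijo d1 d2 (beta * rho ^+ l'),
        xk1 = xk + t *: d1 & yk1 = yk + t *: d2].

End Step.

Definition srpl_sequence (alpha beta rho mu1 mu2 : R)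
    (x : nat -> X) (y : nat -> Y) : Prop :=
  forall k, srpl_step alpha beta rho mu1 mu2 (x k) (y k) (x k.+1) (y k.+1).

End Algorithm.

(* Main.v *)
Require Import Defs.
From HB Require Import structures.
From mathcomp Require Import all_boot all_order all_algebra.
From mathcomp Require Import all_classical all_reals all_analysis.
From mathcomp Require Import ring lra.
Import Order.TTheory GRing.Theory Num.Theory.
Import numFieldNormedType.Exports.
Local Open Scope classical_set_scope.
Local Open Scope ring_scope.

(** Since [Phi] is invariant under scaling of either argument, its partial
    gradient in [x], which is [L1] up to a positive factor, is orthogonal to [x],
    and stationarity holds with zero multipliers as soon as [L1] is nonnegative
    on the cone at the accumulation point. Suppose some [u] in the spectraplex
    makes the regularized model negative there. Then near the accumulation point
    the descent [L1 d1 + L2 d2] stays below a negative constant, and because [Phi]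
    is a cosine, with a second order Taylor remainder controlled only by lower
    bounds on the norms, the Armijo test accepts every step below a fixed
    threshold. So [Phi] decreases by a fixed amount infinitely often, although it
    is nonincreasing and at least -1. Removing the regularization term is a
    first order argument along the segment from the accumulation point to [u]. *)

(** * Inner products: Cauchy-Schwarz, continuity and Riesz representation *)

Section EuclideanSpace.
Context {R : realType} {V : euclideanType R}.
Implicit Types (u v w : V) (a : R).

Lemma innerDl u v w : inner (u + v) w = inner u w + inner v w.
Proof. by have := inner_linearl 1 u v w; rewrite scale1r mul1r. Qed.

Lemma inner0l w : inner 0 w = 0.
Proof. by have := innerDl 0 0 w; rewrite addr0; lra. Qed.

Lemma innerZl a u w : inner (a *: u) w = a * inner u w.
Proof. by have := inner_linearl a u 0 w; rewrite inner0l !addr0. Qed.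

Lemma innerNl u w : inner (- u) w = - inner u w.
Proof. by rewrite -scaleN1r innerZl mulN1r. Qed.

Lemma innerBl u v w : inner (u - v) w = inner u w - inner v w.
Proof. by rewrite innerDl innerNl. Qed.

Lemma innerDr u v w : inner w (u + v) = inner w u + inner w v.
Proof. by rewrite !(innerC w) innerDl. Qed.

Lemma inner0r w : inner w 0 = 0.
Proof. by rewrite innerC inner0l. Qed.

Lemma innerZr a u w : inner w (a *: u) = a * inner w u.
Proof. by rewrite !(innerC w) innerZl. Qed.

Lemma innerBr u v w : inner w (u - v) = inner w u - inner w v.
Proof. by rewrite !(innerC w) innerBl. Qed.

Lemma inner_suml n (f : 'I_n -> V) w :
  inner (\sum_(i < n) f i) w = \sum_(i < n) inner (f i) w.
Proof. exact: (big_morph (inner^~ w) (fun u v => innerDl u v w) (inner0l w)). Qed.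

Lemma inner_ge0 u : 0 <= inner u u.
Proof. by rewrite inner_norm sqr_ge0. Qed.

Lemma inner_eq0 u : inner u u = 0 -> u = 0.
Proof. by rewrite inner_norm => /eqP; rewrite sqrf_eq0 normr_eq0 => /eqP. Qed.

Lemma inner_gt0 u : u <> 0 -> 0 < inner u u.
Proof.
by move=> u0; rewrite lt_def inner_ge0 andbT; apply/eqP => /inner_eq0.
Qed.

(** The triangle inequality is already known for the norm; squaring and expanding it gives the upper
    bound, and replacing [u] by [- u] the lower one. *)
Lemma cauchy_schwarz u v : `|inner u v| <= `|u| * `|v|.
Proof.
suff le_inner (x y : V) : inner x y <= `|x| * `|y|.
  rewrite ler_norml le_inner andbT lerNl -innerNl -[`|u|]normrN.
  exact: le_inner.
have: `|x + y| ^+ 2 <= (`|x| + `|y|) ^+ 2.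
  by rewrite ler_sqr ?nnegrE ?addr_ge0 ?ler_normD.
rewrite -inner_norm innerDl !innerDr (innerC y x) !inner_norm; lra.
Qed.

(** By polarization the inner product is a combination of squared norms, so its continuity reduces
    to that of the norm. *)
Lemma inner_cvg (T : Type) (F : set_system T) {FF : Filter F} (f g : T -> V)
    (u v : V) :
  f @ F --> u -> g @ F --> v -> (fun t => inner (f t) (g t)) @ F --> inner u v.
Proof.
move=> fu gv.
have polar (x y : V) : inner x y = 2^-1 * (`|x + y| ^+ 2 - `|x| ^+ 2 - `|y| ^+ 2).
  by rewrite -!inner_norm innerDl !innerDr (innerC y x); field.
rewrite polar (_ : (fun t => _) =
  fun t => 2^-1 * (`|f t + g t| ^+ 2 - `|f t| ^+ 2 - `|g t| ^+ 2)); last first.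
  by apply/funext => t; exact: polar.
apply: cvgM; first exact: cvg_cst.
have nfg : (fun t => `|f t + g t|) @ F --> `|u + v| by apply: cvg_norm; exact: cvgD.
by apply: cvgB; [apply: cvgB|]; rewrite expr2; apply: cvgM => //; exact: cvg_norm.
Qed.

(** On a basis [b], the Gram operator sending [v] to the sum of [inner v b_i *: b_i] is injective,
    hence invertible. The representing vector is the preimage of the sum of [phi b_i *: b_i]. *)
Lemma riesz (phi : V -> R) :
  (forall a u v, phi (a *: u + v) = a * phi u + phi v) ->
  exists g : V, forall v, phi v = inner g v.
Proof.
move=> phi_lin; pose n := \dim (fullv : {vspace V}).
pose b : n.-tuple V := vbasis fullv.
have phi0 : phi 0 = 0 by have := phi_lin 1 0 0; rewrite scale1r addr0; lra.
have phi_sum (c : 'I_n -> R) :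
    phi (\sum_(i < n) c i *: b`_i) = \sum_(i < n) c i * phi b`_i.
  have phiD u v : phi (u + v) = phi u + phi v.
    by have := phi_lin 1 u v; rewrite scale1r mul1r.
  rewrite (big_morph phi phiD phi0); apply: eq_bigr => i _.
  by rewrite -[_ *: _]addr0 phi_lin phi0 addr0.
have bfree : free b := basis_free (vbasisP fullv).
have T_lin : linear (fun v => \sum_(i < n) inner v b`_i *: b`_i : V).
  move=> a u v /=; rewrite scaler_sumr -big_split /=; apply: eq_bigr => i _.
  by rewrite inner_linearl scalerDl scalerA.
pose Tm := GRing.isLinear.Build _ _ _ _ _ T_lin.
pose T : {linear V -> V} := HB.pack (fun v => \sum_(i < n) inner v b`_i *: b`_i : V) Tm.
have coefs_inj (c d : 'I_n -> R) :
    \sum_(i < n) c i *: b`_i = \sum_(i < n) d i *: b`_i -> c =1 d.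
  by move=> cd i; rewrite -(coord_sum_free c i bfree) cd coord_sum_free.
have ker0 : lker (linfun T) == 0%VS.
  apply/lker0P => u v; rewrite !lfunE /= => /coefs_inj uv.
  apply/subr0_eq/inner_eq0; rewrite {2}(coord_vbasis (memvf (u - v))).
  rewrite innerC inner_suml big1 // => i _.
  by rewrite innerZl innerC innerBl uv subrr mulr0.
exists ((linfun T)^-1%VF (\sum_(i < n) phi b`_i *: b`_i)) => v.
set g := (linfun T)^-1%VF _.
have Tg : T g = \sum_(i < n) phi b`_i *: b`_i by rewrite -(lfunE T) lker0_lfunVK.
rewrite (coord_vbasis (memvf v)) phi_sum innerC inner_suml.
apply: eq_bigr => i _; rewrite innerZl innerC; congr (_ * _).
by have /= /coefs_inj -> := Tg.
Qed.

End EuclideanSpace.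

(** * Boundedness and continuity of linear maps *)

Section LinearMaps.
Context {R : realType} {U V : euclideanType R}.
Implicit Types f : {linear U -> V}.

(** Each coordinate is an inner product with a fixed vector, so Cauchy-Schwarz bounds it by a
    multiple of the norm. The added 1 keeps the constant positive even in dimension 0. *)
Lemma linear_norm_le f : exists2 C, 0 < C & forall u, `|f u| <= C * `|u|.
Proof.
pose b := vbasis (fullv : {vspace U}).
have /choice[g gE] : forall i : 'I_(\dim (fullv : {vspace U})), exists g : U,
    forall u, coord b i u = inner g u.
  by move=> i; apply: riesz => a u v; rewrite linearP.
exists (1 + \sum_i `|g i| * `|f b`_i|) => [|u].
  by rewrite ltr_pwDl // sumr_ge0 // => i _; rewrite mulr_ge0.
rewrite mulrDl mul1r ler_wpDl // {1}(coord_vbasis (memvf u)) linear_sum.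
apply: le_trans (ler_norm_sum _ _ _) _; rewrite mulr_suml ler_sum // => i _.
rewrite linearZ normrZ mulrAC ler_wpM2r // gE.
exact: cauchy_schwarz.
Qed.

Lemma linear_cvg f (T : Type) (F : set_system T) {FF : Filter F} (h : T -> U)
    (u : U) :
  h @ F --> u -> (fun t => f (h t)) @ F --> f u.
Proof.
have [C C0 fC] := linear_norm_le f.
move=> hu; apply/cvgrPdist_lt => e e0.
have /cvgrPdist_lt/(_ (e / C)) := hu; rewrite divr_gt0 // => /(_ isT).
apply: filterS => t; rewrite ltr_pdivlMr // mulrC -linearB.
exact: le_lt_trans.
Qed.

End LinearMaps.

(** * Gradients from a quadratic remainder *)

Section Gradient.
Context {R : realType} {V : euclideanType R}.

Lemma is_gradient_quadratic (f : V -> R) (u g : V) (e C : R) :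
  0 < e ->
  (forall h, `|h| < e -> `|f (u + h) - f u - inner g h| <= C * `|h| ^+ 2) ->
  is_gradient f u g.
Proof.
move=> e0 fC; have g_lin : linear (inner g : V -> R).
  by move=> a v w; rewrite innerDr innerZr.
pose Lm := GRing.isLinear.Build _ _ _ _ _ g_lin.
pose L : {linear V -> R} := HB.pack (inner g : V -> R) Lm.
have L_cont : continuous L.
  by move=> v; apply: inner_cvg; [exact: cvg_cst | exact: cvg_id].
have f_diff : f \o shift u = cst (f u) + L +o_ 0 id.
  apply/eqaddoP => _/posnumP[eps].
  near=> h.
  have he : `|h| < e by near: h; exact: nbhs0_lt.
  have hC : `|h| <= eps%:num / (1 + `|C|).
    by near: h; apply: nbhs0_le; rewrite divr_gt0 // ltr_pwDl.
  have -> : (f \o shift u - (cst (f u) + L)) h = f (u + h) - f u - inner g h.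
    by rewrite /= !fctE /= opprD addrA [h + u]addrC.
  apply: le_trans (fC _ he) _.
  rewrite expr2 mulrA ler_wpM2r // (le_trans (ler_wpM2r _ (ler_norm C))) //.
  move: hC; rewrite ler_pdivlMr ?ltr_pwDl //; have := normr_ge0 h; lra.
have dE := diff_unique L_cont f_diff.
split; last by move=> h; rewrite dE.
by apply/diff_locallyP; rewrite dE.
Unshelve. all: by end_near. Qed.

End Gradient.

(** * Second order estimates for the cosine of two vectors *)

(** Scalar core of [dir_taylor]: [rho] stands for the norm of [p + a] over that of [p], and [s] for
    the normalized inner product. To first order [rho] is [1 + s], so its inverse is [1 - s]. *)
Lemma inv_taylor (R : realFieldType) (rho s a : R) :
  0 <= a <= 1 / 2 -> `|s| <= a -> `|rho - 1| <= a -> rho ^+ 2 = 1 + 2 * s + a ^+ 2 ->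
  `|rho^-1 - 1 + s| + `|rho^-1 - 1| * a <= 8 * a ^+ 2.
Proof.
move=> /andP[a0 a1] sa ra rhoE.
have rho_ge : 1 / 2 <= rho by move: ra; rewrite ler_norml; lra.
have w2 : `|rho^-1| <= 2.
  by rewrite ger0_norm ?invr_ge0; [rewrite -[2]invrK lef_pV2 ?posrE|]; lra.
have E1 : rho^-1 - 1 = rho^-1 * (1 - rho) by field; lra.
have E2 : rho^-1 - 1 + s = rho^-1 * ((1 - rho + s) + s * (rho - 1)) by field; lra.
have bs : `|s * (rho - 1)| <= a ^+ 2 by rewrite normrM expr2 ler_pM.
have be : `|1 - rho + s| <= 2 * a ^+ 2.
  (* Multiplying by [rho + 1], which is at least 1, brings in [rho ^+ 2]; the first order terms then
     cancel. *)
  have : `|(1 - rho + s) * (rho + 1)| <= 2 * a ^+ 2.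
    rewrite (_ : (1 - rho + s) * (rho + 1) = s * (rho - 1) - a ^+ 2); last first.
      by rewrite (_ : a ^+ 2 = rho ^+ 2 - 1 - 2 * s); [ring|lra].
    by apply: le_trans (ler_normB _ _) _; rewrite (ger0_norm (sqr_ge0 a)); lra.
  rewrite normrM (@ger0_norm _ (rho + 1)); last by lra.
  by apply: le_trans; rewrite ler_peMr //; lra.
have b2 : `|rho^-1 - 1 + s| <= 6 * a ^+ 2.
  rewrite E2 normrM (_ : 6 * a ^+ 2 = 2 * (3 * a ^+ 2)); last by ring.
  by rewrite ler_pM // (le_trans (ler_normD _ _)) //; lra.
have b1 : `|rho^-1 - 1| * a <= 2 * a ^+ 2.
  by rewrite expr2 mulrA ler_wpM2r // E1 normrM ler_pM // distrC.
by lra.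
Qed.

Section Cosine.
Context {R : realType} {V : euclideanType R}.
Implicit Types p q a b : V.

Definition cosine p q : R := inner p q / (`|p| * `|q|).

(** Derivative of [cosine] in its first argument, in the direction [a]. *)
Definition dcosine p q a : R :=
  (inner a q - inner p q / `|p| ^+ 2 * inner p a) / (`|p| * `|q|).

Lemma cosineC p q : cosine p q = cosine q p.
Proof. by rewrite /cosine innerC mulrC [`|p| * _]mulrC mulrC. Qed.

Lemma cosine_ge p q : -1 <= cosine p q.
Proof.
rewrite /cosine; have [/eqP|] := eqVneq (`|p| * `|q|) 0.
  by move=> /eqP ->; rewrite invr0 mulr0 lerN10.
rewrite neq_lt ltNge mulr_ge0 //= => pq0; rewrite ler_pdivlMr // mulN1r.
by have /ler_normlP[] := cauchy_schwarz p q; rewrite lerNl.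
Qed.

Lemma add_half_neq0 p a : p <> 0 -> `|a| <= `|p| / 2 -> p + a <> 0.
Proof.
move=> /eqP; rewrite -normr_gt0 => p0 ap pa0.
have : `|p| = `|a| by rewrite -(addrK a p) pa0 sub0r normrN.
by lra.
Qed.

Definition dir p : V := `|p|^-1 *: p.
(** Derivative of the normalization [dir] at [p] in the direction [a]. *)
Definition ddir p a : V := `|p|^-1 *: a - (inner p a / `|p| ^+ 3) *: p.

Lemma dir_norm p : p <> 0 -> `|dir p| = 1.
Proof.
by move=> /eqP; rewrite -normr_gt0 => p0; rewrite normrZ normfV normr_id mulVf // gt_eqF.
Qed.

Lemma ddir_norm p a : p <> 0 -> `|ddir p a| <= 2 * (`|a| / `|p|).
Proof.
move=> /eqP; rewrite -normr_gt0 => p0; apply: le_trans (ler_normB _ _) _.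
rewrite !normrZ !normfV normrX !normr_id.
have: `|inner p a| / `|p| ^+ 3 * `|p| <= `|a| / `|p|.
  rewrite (_ : `|inner p a| / `|p| ^+ 3 * `|p| = `|inner p a| / `|p| ^+ 2);
    last by field; rewrite gt_eqF.
  rewrite ler_pdivrMr ?exprn_gt0 //.
  rewrite (_ : `|a| / `|p| * `|p| ^+ 2 = `|p| * `|a|); last by field; rewrite gt_eqF.
  exact: cauchy_schwarz.
by rewrite [_^-1 * _]mulrC; lra.
Qed.

Lemma dir_taylor p a : p <> 0 -> `|a| <= `|p| / 2 ->
  `|dir (p + a) - dir p - ddir p a| <= 8 * (`|a| / `|p|) ^+ 2.
Proof.
move=> /eqP; rewrite -normr_gt0 => p0 ap.
have CS := cauchy_schwarz p a.
have rE : `|p + a| ^+ 2 = `|p| ^+ 2 + 2 * inner p a + `|a| ^+ 2.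
  by rewrite -!inner_norm innerDl !innerDr (innerC a p); ring.
have r_lo : `|p| <= `|p + a| + `|a|.
  by rewrite -{1}(addrK a p) -[`|a|]normrN ler_normD.
have r_hi := ler_normD p a.
(* The remainder is split along [p] and [a]; the two coefficients are the two quantities bounded in
   [inv_taylor]. *)
have -> : dir (p + a) - dir p - ddir p a =
    (`|p + a|^-1 - `|p|^-1 + inner p a / `|p| ^+ 3) *: p +
    (`|p + a|^-1 - `|p|^-1) *: a.
  rewrite /dir /ddir opprB !scalerDr !scalerDl !scaleNr.
  rewrite -!addrA; congr (_ + _); rewrite [LHS]addrCA; congr (_ + _).
  by rewrite addrCA; congr (_ + _); rewrite addrC addrCA addrC.
apply: (@le_trans _ _ _ _ _ (ler_normD _ _)).
rewrite [X in X + _]normrZ [X in _ + X]normrZ.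
have n0 := gt_eqF p0.
have := @inv_taylor R (`|p + a| / `|p|) (inner p a / `|p| ^+ 2) (`|a| / `|p|).
have -> : (`|p + a| / `|p|)^-1 - 1 + inner p a / `|p| ^+ 2 =
    (`|p + a|^-1 - `|p|^-1 + inner p a / `|p| ^+ 3) * `|p|.
  rewrite invfM invrK !mulrDl mulNr mulVf ?n0 //; congr (_ + _).
  by field; rewrite n0.
have -> : (`|p + a| / `|p|)^-1 - 1 = (`|p + a|^-1 - `|p|^-1) * `|p|.
  by rewrite invfM invrK !mulrDl mulNr mulVf ?n0.
move=> taylor.
have -> : forall c d : R, `|c| * `|p| + `|d| * `|a| =
    `|c * `|p| | + `|d * `|p| | * (`|a| / `|p|).
  by move=> c d; rewrite !normrM normr_id; field; rewrite n0.
apply: taylor.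
- by rewrite divr_ge0 //= ler_pdivrMr // mulrC mul1r.
- rewrite normrM normfV normrX normr_id ler_pdivrMr ?exprn_gt0 //.
  by rewrite expr2 mulrA divfK ?n0 // mulrC.
- have -> : `|p + a| / `|p| - 1 = (`|p + a| - `|p|) / `|p| by field; rewrite n0.
  rewrite normrM normfV normr_id ler_pM2r ?invr_gt0 //.
  by rewrite ler_norml; lra.
- by rewrite !exprMn rE -!exprVn; field; rewrite n0.
Qed.

(** The cosine is the inner product of the two directions, so the product rule applies to their
    expansions. The remainder depends only on relative increments, hence is uniform once the norms
    are bounded below. *)
Lemma cosine_taylor p q a b : p <> 0 -> q <> 0 ->
  `|a| <= `|p| / 2 -> `|b| <= `|q| / 2 ->
  `|cosine (p + a) (q + b) - cosine p q - (dcosine p q a + dcosine q p b)|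
    <= 18 * ((`|a| / `|p|) ^+ 2 + (`|b| / `|q|) ^+ 2).
Proof.
move=> p0 q0 ap bq.
have cosE u v : cosine u v = inner (dir u) (dir v).
  by rewrite innerZl innerZr /cosine invfM; ring.
have pa0 := add_half_neq0 _ _ p0 ap; have qb0 := add_half_neq0 _ _ q0 bq.
have dcosE u v w : u <> 0 -> v <> 0 -> dcosine u v w = inner (ddir u w) (dir v).
  move=> /eqP; rewrite -normr_eq0 => u0 /eqP; rewrite -normr_eq0 => v0.
  rewrite /dcosine /ddir /dir innerZr innerBl !innerZl; field.
  by rewrite u0 v0.
have [x0 xle] : 0 <= `|a| / `|p| /\ `|a| / `|p| <= 1 / 2.
  move/eqP: p0; rewrite -normr_gt0 => p0.
  by rewrite divr_ge0 // ler_pdivrMr // mulrC mul1r.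
have [y0 yle] : 0 <= `|b| / `|q| /\ `|b| / `|q| <= 1 / 2.
  move/eqP: q0; rewrite -normr_gt0 => q0.
  by rewrite divr_ge0 // ler_pdivrMr // mulrC mul1r.
have := dir_taylor _ _ p0 ap; have := dir_taylor _ _ q0 bq.
have := ddir_norm _ a p0; have := ddir_norm _ b q0.
rewrite !cosE !dcosE //.
set r := dir (p + a) - _ - _; set s := dir (q + b) - _ - _.
move: (`|a| / `|p|) (`|b| / `|q|) x0 xle y0 yle => x y x0 xle y0 yle hb ha hs hr.
(* What the product rule leaves: the product of the first order parts, and each direction remainder
   against a bounded vector. They contribute at most [4 x y], [16 y^2] and [8 x^2]. *)
have -> : inner (dir (p + a)) (dir (q + b)) - inner (dir p) (dir q) -
    (inner (ddir p a) (dir q) + inner (ddir q b) (dir p)) =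
    inner (ddir p a) (ddir q b) + (inner (dir p + ddir p a) s + inner r (dir (q + b))).
  rewrite /r /s (innerC _ (dir p)).
  move: (dir (p + a)) (dir (q + b)) (dir p) (dir q) (ddir p a) (ddir q b).
  by move=> P Q u v da db; rewrite !innerBl !innerBr !innerDl; ring.
have n1 : `|dir p + ddir p a| <= 2.
  by apply: le_trans (ler_normD _ _) _; rewrite dir_norm //; lra.
have b1 : `|inner (ddir p a) (ddir q b)| <= 2 * x * (2 * y).
  by apply: le_trans (cauchy_schwarz _ _) _; rewrite ler_pM.
have b2 : `|inner (dir p + ddir p a) s| <= 2 * (8 * y ^+ 2).
  by apply: le_trans (cauchy_schwarz _ _) _; rewrite ler_pM.
have b3 : `|inner r (dir (q + b))| <= 8 * x ^+ 2.
  by apply: le_trans (cauchy_schwarz _ _) _; rewrite dir_norm // mulr1.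
apply: le_trans (ler_normD _ _) _.
have := ler_normD (inner (dir p + ddir p a) s) (inner r (dir (q + b))).
have := sqr_ge0 (x - y); have := sqr_ge0 x; have := sqr_ge0 y.
rewrite sqrrB; nra.
Qed.

End Cosine.

(** * Jordan algebras: linearized identity and idempotents *)

Section JordanAlgebra.
Context {R : realType} {X : ejaType R}.
Implicit Types x y z w c : X.

Lemma jmulDl x y z : jmul (x + y) z = jmul x z + jmul y z.
Proof. by have := jmul_linearl 1 x y z; rewrite !scale1r. Qed.

Lemma jmul0l z : jmul 0 z = 0.
Proof. by apply: (addIr (jmul 0 z)); rewrite -jmulDl !add0r. Qed.

Lemma jmulZl a x z : jmul (a *: x) z = a *: jmul x z.
Proof. by have := jmul_linearl a x 0 z; rewrite jmul0l !addr0. Qed.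

Lemma jmulDr x y z : jmul z (x + y) = jmul z x + jmul z y.
Proof. by rewrite !(jmulC z) jmulDl. Qed.

Lemma jmulNl x z : jmul (- x) z = - jmul x z.
Proof. by rewrite -(scaleN1r x) jmulZl scaleN1r. Qed.

Lemma jmulNr x z : jmul z (- x) = - jmul z x.
Proof. by rewrite !(jmulC z) jmulNl. Qed.

Lemma jmul_suml n (f : 'I_n -> X) z :
  jmul (\sum_(i < n) f i) z = \sum_(i < n) jmul (f i) z.
Proof. exact: (big_morph (jmul^~ z) (fun u v => jmulDl u v z) (jmul0l z)). Qed.

Lemma inner_ext x y : (forall w, inner x w = inner y w) -> x = y.
Proof.
by move=> xy; apply/subr0_eq/inner_eq0; rewrite innerBl xy subrr.
Qed.

(** The Jordan identity is cubic in its first argument. Half the difference of its instances at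
    [x + z] and [x - z], minus the instance at [z], is the part linear in [z]. *)
Lemma jordan_linearized x z y :
  jmul z (jmul (jmul x x) y) + 2 *: jmul x (jmul (jmul x z) y) =
  jmul (jmul x x) (jmul z y) + 2 *: jmul (jmul x z) (jmul x y).
Proof.
have := jordan_identity (x + z) y; have := jordan_identity (x - z) y.
have := jordan_identity z y.
rewrite !(jmulDl, jmulDr, jmulNl, jmulNr) (jmulC z x) => h1 h2 h3.
(* Pairing with an arbitrary [w] turns vector identities into scalar ones, within reach of linear
   arithmetic. *)
apply: inner_ext => w; move: (congr1 (inner^~ w) h1) (congr1 (inner^~ w) h2).
move: (congr1 (inner^~ w) h3).
by rewrite !(innerDl, innerNl, innerZl); lra.
Qed.

(* Peirce: L_c is annihilated by 2 t^3 - 3 t^2 + t. *)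
Lemma idempotent_cubic c z : jidempotent c ->
  2 *: jmul c (jmul c (jmul c z)) + jmul c z = 3 *: jmul c (jmul c z).
Proof.
rewrite /jidempotent => cc; have := jordan_linearized c z c.
rewrite !cc (jmulC z c) (jmulC (jmul c z) c) => e.
apply: inner_ext => w; move: (congr1 (inner^~ w) e).
by rewrite !(innerDl, innerZl); lra.
Qed.

(* On the Peirce spectrum {0, 1/2, 1} one has t = t^2 + 4 (t - t^2)^2. *)
Lemma idempotent_psd c z : jidempotent c -> 0 <= inner (jmul c z) z.
Proof.
move=> cc; set u := jmul c z; set v := jmul c u.
have e := congr1 (inner^~ z) (idempotent_cubic c z cc).
have f := congr1 (inner^~ u) (idempotent_cubic c z cc).
have uv : inner (jmul c v) z = inner v u by rewrite inner_jmul.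
have vv : inner (jmul c v) u = inner v v by rewrite inner_jmul.
have uu : inner u u = inner v z by rewrite [RHS]inner_jmul.
have := inner_ge0 u; have := inner_ge0 (u - v).
rewrite innerBl !innerBr (innerC u v).
move: e f; rewrite !(innerDl, innerZl) -/u -/v uv vv uu; lra.
Qed.

Lemma inner_square_idempotent w c :
  jidempotent c -> 0 <= inner (jmul w w) c.
Proof.
by move=> cc; rewrite inner_jmul (jmulC w) innerC; exact: idempotent_psd.
Qed.

Lemma inner_one_square w : inner jone (jmul w w) = inner w w.
Proof. by rewrite innerC inner_jmul jmulC jmul1x. Qed.

Lemma inner_one_cone_gt0 x : symmetric_cone X x -> x <> 0 -> 0 < inner jone x.
Proof.
move=> [w ->] w0; rewrite inner_one_square; apply: inner_gt0 => {}w0'.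
by apply: w0; rewrite w0' jmul0l.
Qed.

Lemma idempotent_cone c : jidempotent c -> symmetric_cone X c.
Proof. by move=> cc; exists c. Qed.

(** * Calculus in a Jordan frame *)

Section Frame.
Context {r : nat} {c : 'I_r -> X}.
Hypothesis c_frame : jordan_frame c.

Let cI i : jidempotent (c i).
Proof. by case: c_frame => + _ _ => /(_ i)[]. Qed.

Let cO i j : i != j -> jmul (c i) (c j) = 0.
Proof. by case: c_frame => _ + _; apply. Qed.

Lemma frame_norm_gt0 i : 0 < inner (c i) (c i).
Proof. by apply: inner_gt0; case: c_frame => + _ _ => /(_ i)[]. Qed.

Lemma frame_orthogonal i j : i != j -> inner (c i) (c j) = 0.
Proof. by move=> ij; rewrite -(cI i) inner_jmul cO // inner0r. Qed.

Lemma inner_frame (lam : 'I_r -> R) j :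
  inner (\sum_(i < r) lam i *: c i) (c j) = lam j * inner (c j) (c j).
Proof.
rewrite inner_suml (bigD1 j) //= innerZl big1 ?addr0 // => i ij.
by rewrite innerZl frame_orthogonal // mulr0.
Qed.

Lemma jmul_frame_r (lam : 'I_r -> R) j :
  jmul (\sum_(i < r) lam i *: c i) (c j) = lam j *: c j.
Proof.
rewrite jmul_suml (bigD1 j) //= jmulZl cI big1 ?addr0 // => i ij.
by rewrite jmulZl cO // scaler0.
Qed.

Lemma jmul_frame (a b : 'I_r -> R) :
  jmul (\sum_(i < r) a i *: c i) (\sum_(i < r) b i *: c i) =
  \sum_(i < r) (a i * b i) *: c i.
Proof.
rewrite jmulC jmul_suml; apply: eq_bigr => i _.
by rewrite jmulZl jmulC jmul_frame_r scalerA mulrC.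
Qed.

Lemma frame_cone (lam : 'I_r -> R) :
  (forall i, 0 <= lam i) -> symmetric_cone X (\sum_(i < r) lam i *: c i).
Proof.
move=> lam0; exists (\sum_(i < r) Num.sqrt (lam i) *: c i).
rewrite jmul_frame; apply: eq_bigr => i _.
by rewrite -expr2 sqr_sqrtr.
Qed.

Lemma inner_one_frame (lam : 'I_r -> R) :
  inner jone (\sum_(i < r) lam i *: c i) =
  \sum_(i < r) lam i * inner (c i) (c i).
Proof.
rewrite innerC inner_suml; apply: eq_bigr => i _.
by rewrite innerZl innerC -{1}(cI i) inner_one_square.
Qed.

End Frame.

(** * Spectral decomposition, self-duality and compactness of the spectraplex *)

Hypothesis scX : scalarizable X.

(** A nonzero value cannot be the default 0 of [xget], so the set defining the trace is
    inhabited. *)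
Lemma jtr_spectral x : jtr x <> 0 -> exists r (c : 'I_r -> X) lam,
  spectral_decomposition c lam x /\ jtr x = \sum_(i < r) lam i.
Proof.
rewrite /jtr; case: xgetP => [t _ [r [c [lam [s ->]]]]|//] _.
by exists r, c, lam.
Qed.

(* By scalarizability the trace of x is a multiple of <e, x>, and the junk value
   0 of the trace is the only obstruction to a spectral decomposition. *)
Lemma spectral x : exists r (c : 'I_r -> X) lam, spectral_decomposition c lam x.
Proof.
have [kappa kappa0 trE] := scX.
have gen y : inner jone y <> 0 ->
    exists r (c : 'I_r -> X) lam, spectral_decomposition c lam y.
  rewrite trE jmul1x => y0; have /jtr_spectral : jtr y <> 0.
    by move=> y0'; apply: y0; rewrite y0' mulr0.
  by move=> [r [c [lam [s _]]]]; exists r, c, lam.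
have [e0|/eqP/inner_gt0 e0] := eqVneq (jone : X) 0.
  have x0 : x = 0 by rewrite -(jmul1x x) e0 jmul0l.
  by exists 0%N, (fun=> 0), (fun=> 0); split; [split; [case|case|]|]; rewrite ?big_ord0.
have [ex0|/eqP/gen//] := eqVneq (inner jone x) 0.
(* The shift by the unit makes the trace nonzero; the frame found for [x + jone] also serves [x],
   with every eigenvalue lowered by 1. *)
have /gen[r [c [lam [cF xe]]]] : inner jone (x + jone) <> 0.
  by rewrite innerDr ex0 add0r => ee; rewrite ee ltxx in e0.
exists r, c, (fun i => lam i - 1); split=> //.
rewrite (eq_bigr (fun i => lam i *: c i - c i)); last first.
  by move=> i _; rewrite scalerBl scale1r.
by rewrite big_split sumrN /= -xe; case: cF => _ _ ->; rewrite addrK.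
Qed.

(** Pairing [x] with a frame element isolates its eigenvalue up to a positive factor. *)
Lemma spectral_ge0 x :
  (forall c, jidempotent c -> 0 <= inner x c) ->
  exists r (c : 'I_r -> X) lam,
    spectral_decomposition c lam x /\ forall i, 0 <= lam i.
Proof.
move=> x0; have [r [c [lam [cF xE]]]] := spectral x.
exists r, c, lam; split=> // i; rewrite -(pmulr_lge0 _ (frame_norm_gt0 cF i)).
rewrite -inner_frame // -xE; apply: x0.
by case: cF => + _ _ => /(_ i)[].
Qed.

Lemma spectral_cone x : symmetric_cone X x ->
  exists r (c : 'I_r -> X) lam,
    spectral_decomposition c lam x /\ forall i, 0 <= lam i.
Proof.
by move=> [w ->]; apply: spectral_ge0 => c; exact: inner_square_idempotent.
Qed.

(** Self-duality of the symmetric cone. Convexity and closedness, not visible on the set of squares,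
    are read off this form. *)
Lemma symmetric_cone_dual x :
  symmetric_cone X x <-> forall z, 0 <= inner x (jmul z z).
Proof.
split=> [/spectral_cone[r [c [lam [[cF ->] lam0]]]] z|x0].
  rewrite inner_suml sumr_ge0 // => i _; rewrite innerZl mulr_ge0 // innerC.
  by apply: inner_square_idempotent; case: cF => + _ _ => /(_ i)[].
have [|r [c [lam [[cF ->] lam0]]]] := spectral_ge0 x; last exact: frame_cone.
by move=> c cc; rewrite -cc.
Qed.

Lemma symmetric_coneD x y :
  symmetric_cone X x -> symmetric_cone X y -> symmetric_cone X (x + y).
Proof.
move=> /symmetric_cone_dual x0 /symmetric_cone_dual y0.
by apply/symmetric_cone_dual => z; rewrite innerDl addr_ge0.
Qed.

Lemma symmetric_coneZ a x :
  0 <= a -> symmetric_cone X x -> symmetric_cone X (a *: x).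
Proof.
move=> a0 /symmetric_cone_dual x0.
by apply/symmetric_cone_dual => z; rewrite innerZl mulr_ge0.
Qed.

Lemma symmetric_cone_sum n (f : 'I_n -> X) (P : pred 'I_n) :
  (forall i, symmetric_cone X (f i)) ->
  symmetric_cone X (\sum_(i < n | P i) f i).
Proof.
move=> f0; elim/big_ind : _ => // [|x y]; last exact: symmetric_coneD.
by exists 0; rewrite jmul0l.
Qed.

Lemma spectraplex_segment x y (t : R) : 0 <= t <= 1 ->
  spectraplex X x -> spectraplex X y -> spectraplex X (x + t *: (y - x)).
Proof.
move=> /andP[t0 t1] [Kx x1] [Ky y1]; split; last first.
  by rewrite innerDr innerZr innerBr x1 y1 subrr mulr0 addr0.
have -> : x + t *: (y - x) = (1 - t) *: x + t *: y.
  by rewrite scalerBr scalerBl scale1r [t *: y - _]addrC addrA.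
by apply: symmetric_coneD; apply: symmetric_coneZ => //; rewrite subr_ge0.
Qed.

Lemma spectraplex_neq0 x : spectraplex X x -> x <> 0.
Proof. by move=> [_ + x0]; rewrite x0 inner0r => /eqP; rewrite eq_sym oner_eq0. Qed.

Lemma spectraplex_closed : closed (spectraplex X).
Proof.
have -> : spectraplex X = [set x | forall z, 0 <= inner x (jmul z z)] `&`
    [set x | inner jone x = 1].
  by apply/seteqP; split=> x [] /symmetric_cone_dual.
have inner_cont w : continuous (inner w : X -> R).
  by move=> v; apply: inner_cvg; [exact: cvg_cst | exact: cvg_id].
apply: closedI.
  have -> : [set x | forall z : X, 0 <= inner x (jmul z z)] =
      \bigcap_(z in [set: X]) (inner (jmul z z) @^-1` [set t | 0 <= t]).
    apply/seteqP; split=> x /= x0 => [z _ /=|z]; rewrite innerC //.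
    exact: x0.
  apply: closed_bigI => z _; apply: closed_comp => [v _|]; last exact: closed_ge.
  exact: inner_cont.
rewrite (_ : [set x | _] = inner jone @^-1` [set 1]) //.
by apply: closed_comp => [v _|]; [exact: inner_cont|exact: closed_eq].
Qed.

(** The eigenvalues of an idempotent are 0 or 1, so a nonzero one has trace at least 1, and
    [inner c c] is [kappa] times that trace. *)
Lemma idempotent_norm_ge :
  exists2 k : R, 0 < k & forall c, jidempotent c -> c <> 0 -> k <= inner c c.
Proof.
have [kappa kappa0 trE] := scX; exists kappa => // c cc c0.
have := inner_gt0 c c0; rewrite trE cc pmulr_rgt0 // => t0.
rewrite ler_peMr ?(ltW kappa0) //.
have [|r [d [lam [[dF cE] jE]]]] := jtr_spectral c; first by move=> e; rewrite e ltxx in t0.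
have lam01 i : lam i ^+ 2 = lam i.
  have := congr1 (inner^~ (d i)) cc; rewrite cE jmul_frame // !inner_frame //.
  by move/mulIf; apply; rewrite gt_eqF // frame_norm_gt0.
have lam_ge0 i : 0 <= lam i by rewrite -lam01 sqr_ge0.
have [i li] : exists i, lam i != 0.
  apply/not_existsP => l0; move: t0; rewrite jE big1 ?ltxx // => i _.
  by apply/eqP/negPn/negP/l0.
have l1 : lam i = 1 by apply: (mulfI li); rewrite -expr2 lam01 mulr1.
by rewrite jE (bigD1 i) //= l1 ler_wpDr // sumr_ge0.
Qed.

Lemma spectraplex_bounded : exists2 M : R, 0 < M &
  forall x, spectraplex X x -> `|x| <= M.
Proof.
have [k k0 kP] := idempotent_norm_ge.
(* Trades norms for squared norms: the sum of [lam i * inner (c i) (c i)] is [inner jone x], which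
   is 1. *)
have nP c : jidempotent c -> c <> 0 -> `|c| <= (1 + k^-1) * inner c c.
  move=> cc c0; have kc := kP c cc c0.
  have : 1 <= k^-1 * inner c c by rewrite ler_pdivlMl // mulr1.
  rewrite mulrDl mul1r; have := sqr_ge0 (`|c| - 1); rewrite sqrrB inner_norm.
  by have := normr_ge0 c; nra.
exists (1 + k^-1) => [|x [/spectral_cone[r [c [lam [[cF ->] lam0]]]]]].
  by rewrite addr_gt0 // invr_gt0.
rewrite inner_one_frame // => s1.
apply: le_trans (ler_norm_sum _ _ _) _.
rewrite -[leRHS]mulr1 -[X in _ <= _ * X]s1 mulr_sumr.
apply: ler_sum => i _; rewrite normrZ ger0_norm // mulrCA ler_wpM2l //.
by apply: nP; case: cF => + _ _ => /(_ i)[].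
Qed.

End JordanAlgebra.

(** If [G x = 0], the image of each spectral term is minus the image of the others, so it lies in
    [P] and in [- P] and vanishes. As [G] kills no primitive idempotent, every eigenvalue is 0. *)
Lemma lisc_neq0 {R : realType} {V : euclideanType R} {X : ejaType R}
    (G : {linear X -> V}) (P : set V) (x : X) :
  scalarizable X -> lisc_representation G P ->
  symmetric_cone X x -> x <> 0 -> G x <> 0.
Proof.
move=> scX [_ GP Gprim Ppt] /(spectral_cone scX)[r [c [lam [[cF xE] lam0]]]] x0 Gx0.
apply: x0; rewrite xE big1 // => j _.
have Kc i : symmetric_cone X (lam i *: c i).
  apply: symmetric_coneZ => //; apply: idempotent_cone.
  by case: cF => + _ _ => /(_ i)[].
have PG y : symmetric_cone X y -> P (G y) by move=> Ky; rewrite -GP; exists y.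
suff /eqP : G (lam j *: c j) = 0.
  rewrite linearZ scaler_eq0 => /orP[/eqP->|/eqP]; first by rewrite scale0r.
  by move=> Gc; exfalso; apply: (Gprim (c j)) => //; case: cF.
have : (P `&` [set - u | u in P]) (G (lam j *: c j)).
  split; first exact: PG.
  exists (G (\sum_(i < r | i != j) lam i *: c i)).
    exact/PG/symmetric_cone_sum.
  apply/eqP; rewrite eq_sym -addr_eq0 -linearD; apply/eqP; rewrite -Gx0 xE.
  by rewrite [in RHS](bigD1 j).
by rewrite Ppt.
Qed.

Lemma frequent_decrease_unbounded {R : realType} (f : nat -> R) (c b : R) :
  0 < c -> (forall k, f k.+1 <= f k) ->
  (forall N, exists2 k, (N <= k)%N & f k.+1 <= f k - c) ->
  exists k, f k < b.
Proof.
move=> c0 f_noninc f_dec.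
have f_le : nonincreasing_seq f by apply/nonincreasing_seqP.
have drop n : exists k, f k <= f 0%N - n%:R * c.
  elim: n => [|n [k fk]]; first by exists 0%N; rewrite mul0r subr0.
  have [j kj fj] := f_dec k; exists j.+1; apply: le_trans fj _.
  by have := f_le _ _ kj; rewrite -natr1; lra.
have [k fk] := drop (Num.truncn ((f 0%N - b) / c)).+1; exists k.
apply: le_lt_trans fk _; rewrite ltrBlDr -ltrBlDl -ltr_pdivrMr //.
exact: truncnS_gt.
Qed.

(** * The linearized model in one block *)

Section PartialModel.
Context {R : realType} {V : euclideanType R} {X Y : ejaType R}.
Variables (G : {linear X -> V}) (H : {linear Y -> V}).
Implicit Types (x u d : X) (y v : Y).

Lemma PhiE x y : Phi G H x y = cosine (G x) (H y).
Proof. by []. Qed.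

Lemma Phi_swap x y : Phi G H x y = Phi H G y x.
Proof. exact: cosineC. Qed.

(** The norm of [H y] cancels against [delta]. When a norm vanishes both coefficients are 0, so the
    formula needs no side condition. *)
Lemma L1E x y d : L1 G H x y d =
  inner (G d) (H y) - inner (G x) (H y) / `|G x| ^+ 2 * inner (G x) (G d).
Proof.
rewrite /L1 /delta innerBr innerZr (innerC (G d) (G x)); congr (_ - _ * _).
have [->|Hy0] := eqVneq (H y) 0; first by rewrite inner0r !mul0r.
have [->|Gx0] := eqVneq (G x) 0; first by rewrite inner0l !mul0r.
by field; rewrite !normr_eq0 Gx0 Hy0.
Qed.

Lemma L1D x y u d : L1 G H x y (u + d) = L1 G H x y u + L1 G H x y d.
Proof. by rewrite /L1 linearD innerDl. Qed.

Lemma L1Z x y a u : L1 G H x y (a *: u) = a * L1 G H x y u.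
Proof. by rewrite /L1 linearZ innerZl. Qed.

Lemma L1B x y u d : L1 G H x y (u - d) = L1 G H x y u - L1 G H x y d.
Proof. by rewrite L1D -scaleN1r L1Z mulN1r. Qed.

Lemma L1_self x y : G x <> 0 -> L1 G H x y x = 0.
Proof.
move=> /eqP; rewrite -normr_eq0 => Gx0; rewrite L1E inner_norm.
by rewrite divfK ?subrr // sqrf_eq0.
Qed.

Lemma L1_dcosine x y d :
  L1 G H x y d / (`|G x| * `|H y|) = dcosine (G x) (H y) (G d).
Proof. by rewrite L1E. Qed.

Lemma L1_cvg u (x : X) (y : Y) : G x <> 0 ->
  (fun z : X * Y => L1 G H z.1 z.2 u) @ nbhs (x, y) --> L1 G H x y u.
Proof.
move=> /eqP; rewrite -normr_eq0 => Gx0.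
have G_cvg : (fun z : X * Y => G z.1) @ nbhs (x, y) --> G x.
  by apply: linear_cvg; exact: cvg_fst.
have H_cvg : (fun z : X * Y => H z.2) @ nbhs (x, y) --> H y.
  by apply: linear_cvg; exact: cvg_snd.
rewrite L1E; under eq_fun do rewrite L1E.
apply: cvgB; first by apply: inner_cvg => //; exact: cvg_cst.
apply: cvgM; last by apply: inner_cvg => //; exact: cvg_cst.
apply: cvgM; first exact: inner_cvg.
apply: cvgV; first by rewrite sqrf_eq0.
by rewrite expr2; apply: cvgM; apply: cvg_norm.
Qed.

(** [L1] vanishes at the current point, so its value on the step is its value at the minimizer, and
    dropping the regularization there only decreases the objective. *)
Lemma minimizer_L1_le mu x y u xt : 0 <= mu -> G x <> 0 ->
  minimizer (fun u => L1 G H x y u + mu / 2 * `|u - x| ^+ 2)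
    (spectraplex X) xt ->
  spectraplex X u ->
  L1 G H x y (xt - x) <= L1 G H x y u + mu / 2 * `|u - x| ^+ 2.
Proof.
move=> mu0 Gx0 [_ /(_ u) min_xt] /min_xt; apply: le_trans.
by rewrite L1B L1_self // subr0 lerDl mulr_ge0 ?divr_ge0 ?sqr_ge0.
Qed.

Lemma minimizer_L1_le0 mu x y xt : 0 <= mu -> G x <> 0 -> spectraplex X x ->
  minimizer (fun u => L1 G H x y u + mu / 2 * `|u - x| ^+ 2)
    (spectraplex X) xt ->
  L1 G H x y (xt - x) <= 0.
Proof.
move=> mu0 Gx0 Dx /minimizer_L1_le/(_ Dx); rewrite L1_self // subrr normr0.
by rewrite expr0n mulr0 addr0; apply.
Qed.

End PartialModel.

(** * Uniform acceptance of small steps *)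

Section LineSearch.
Context {R : realType} {V : euclideanType R} {X Y : ejaType R}.
Variables (G : {linear X -> V}) (H : {linear Y -> V}).
Implicit Types (x u d : X) (y v : Y).

(** Exchanging the roles of the blocks turns every result on [L1] into one on [L2]. *)
Lemma L2E x y v : L2 G H x y v = L1 H G y x v.
Proof.
rewrite L1E /L2 /delta innerBr innerZr (innerC (H v) (H y)); congr (_ - _ * _).
rewrite (innerC (H y)).
have [->|Hy0] := eqVneq (H y) 0; first by rewrite inner0r !mul0r.
have [->|Gx0] := eqVneq (G x) 0; first by rewrite inner0l !mul0r.
by field; rewrite !normr_eq0 Gx0 Hy0.
Qed.

Lemma armijo_small (alpha eta m B : R) :
  0 < alpha < 1 -> 0 < eta -> 0 < m -> 0 < B ->
  exists2 tau : R, 0 < tau & forall x y d (e : Y) (t : R),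
    m <= `|G x| -> m <= `|H y| -> `|G d| <= B -> `|H e| <= B ->
    (L1 G H x y d + L2 G H x y e) / (`|G x| * `|H y|) <= - eta ->
    0 < t <= tau -> armijo G H alpha x y d e t.
Proof.
move=> /andP[a0 a1] eta0 m0 B0.
have a1' : 0 < 1 - alpha by rewrite subr_gt0.
have q0 : 0 < (B / m) ^+ 2 by rewrite exprn_gt0 // divr_gt0.
have q1 : 0 < 36 * (B / m) ^+ 2 by apply: mulr_gt0.
have q2 : 0 < 2 * B by apply: mulr_gt0.
(* The first bound keeps the increments within half the norms, as [cosine_taylor] requires. The
   second lets the slack [(1 - alpha) * eta * t] absorb the remainder, at most
   [2 * 18 * (t * (B / m)) ^+ 2]. *)
exists (Num.min (m / (2 * B)) ((1 - alpha) * eta / (36 * (B / m) ^+ 2))).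
  by rewrite lt_min; apply/andP; split; apply: divr_gt0 => //; exact: mulr_gt0.
move=> x y d e t mG mH dB eB D_le /andP[t0].
rewrite le_min => /andP[]; rewrite ler_pdivlMr // => t_m.
rewrite ler_pdivlMr // => t_eta.
have G0 : 0 < `|G x| := lt_le_trans m0 mG.
have H0 : 0 < `|H y| := lt_le_trans m0 mH.
have Gx0 : G x <> 0 by apply/eqP; rewrite -normr_gt0.
have Hy0 : H y <> 0 by apply/eqP; rewrite -normr_gt0.
have tdB : `|t *: G d| <= t * B by rewrite normrZ gtr0_norm // ler_pM2l.
have teB : `|t *: H e| <= t * B by rewrite normrZ gtr0_norm // ler_pM2l.
have tdG : `|t *: G d| <= `|G x| / 2 by lra.
have teH : `|t *: H e| <= `|H y| / 2 by lra.
have taylor := cosine_taylor _ _ _ _ Gx0 Hy0 tdG teH.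
have ratio (s r : R) : 0 <= s -> s <= t * B -> m <= r -> (s / r) ^+ 2 <= (t * (B / m)) ^+ 2.
  move=> s0 sB mr; have r0 : 0 < r by exact: lt_le_trans mr.
  have sr0 : 0 <= s / r by rewrite divr_ge0 // ltW.
  have srB : s / r <= t * (B / m).
    by rewrite mulrA ler_pM ?invr_ge0 ?(ltW r0) // lef_pV2 ?posrE.
  by rewrite ler_sqr ?nnegrE // (le_trans sr0).
have rG := ratio _ _ (normr_ge0 _) tdB mG.
have rH := ratio _ _ (normr_ge0 _) teB mH.
have dE : dcosine (G x) (H y) (t *: G d) + dcosine (H y) (G x) (t *: H e) =
    t * ((L1 G H x y d + L2 G H x y e) / (`|G x| * `|H y|)).
  rewrite -!linearZ -!L1_dcosine !L1Z L2E mulrC [`|H y| * _]mulrC; ring.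
move: taylor; rewrite dE ler_norml => /andP[_].
have PhitE : Phi G H (x + t *: d) (y + t *: e) =
    cosine (G x + t *: G d) (H y + t *: H e).
  by rewrite PhiE !linearD !linearZ.
rewrite /armijo PhitE PhiE.
move: rG rH; set D := (_ + _) / _ in D_le *.
set cs := cosine _ _; set cs' := cosine _ _.
set r1 := (_ / _) ^+ 2; set r2 := (_ / _) ^+ 2 => rG rH taylor.
have : t * (36 * (t * (B / m) ^+ 2)) <= t * (- (1 - alpha) * D).
  rewrite ler_pM2l //; apply: le_trans (_ : (1 - alpha) * eta <= _); first by lra.
  by rewrite mulNr -mulrN ler_pM2l // lerNr.
rewrite exprMn expr2 in rG rH; lra.
Qed.

End LineSearch.

(** * Descent along the iterates and accumulation points *)

Section Convergence.
Context {R : realType} {V : euclideanType R} {X Y : ejaType R}.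
Context {G : {linear X -> V}} {H : {linear Y -> V}} {P Q : set V}.
Context {alpha beta rho mu1 mu2 : R} {x : nat -> X} {y : nat -> Y}.
Hypotheses (scX : scalarizable X) (scY : scalarizable Y).
Hypotheses (GP : lisc_representation G P) (HQ : lisc_representation H Q).
Hypotheses (alpha01 : 0 < alpha < 1) (beta0 : 0 < beta) (rho01 : 0 < rho < 1).
Hypotheses (mu1_ge0 : 0 <= mu1) (mu2_ge0 : 0 <= mu2).
Hypothesis xy_srpl : srpl_sequence G H alpha beta rho mu1 mu2 x y.

(** With [beta <= 1] every step length lies in the unit interval, so each iterate is a convex
    combination of feasible points. *)
Lemma srpl_feasible k :
  spectraplex X (x 0%N) -> spectraplex Y (y 0%N) -> beta <= 1 ->
  spectraplex X (x k) /\ spectraplex Y (y k).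
Proof.
move=> Dx Dy beta1; elim: k => // k [Dxk Dyk].
have [xt [yt [l [[[Dxt _] [Dyt _] _] [_ _ -> ->]]]]] := xy_srpl k.
have /andP[r0 r1] := rho01.
have t01 : 0 <= beta * rho ^+ l <= 1.
  have b0 := ltW beta0; have rl0 : 0 <= rho ^+ l by rewrite exprn_ge0 // ltW.
  by rewrite mulr_ge0 //= mulr_ile1 // exprn_ile1 // ltW.
by split; exact: spectraplex_segment.
Qed.

Hypothesis Dxy : forall k, spectraplex X (x k) /\ spectraplex Y (y k).

Let Gx_neq0 u : spectraplex X u -> G u <> 0.
Proof.
move=> Du; apply: (lisc_neq0 G P) => //; first by case: Du.
exact: spectraplex_neq0.
Qed.

Let Hy_neq0 v : spectraplex Y v -> H v <> 0.
Proof.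
move=> Dv; apply: (lisc_neq0 H Q) => //; first by case: Dv.
exact: spectraplex_neq0.
Qed.

(** Either the first trial step [beta] was accepted or the step is at least [rho * tau]; the minimum
    bounds it below in both cases. *)
Lemma srpl_decrease_at (tau eta : R) k xt yt (l : nat) :
  let d1 := xt - x k in let d2 := yt - y k in
  let D := (L1 G H (x k) (y k) d1 + L2 G H (x k) (y k) d2) /
    (`|G (x k)| * `|H (y k)|) in
  let t := beta * rho ^+ l in
  0 <= tau -> 0 <= eta -> D <= - eta ->
  armijo G H alpha (x k) (y k) d1 d2 t ->
  (l = 0%N \/ rho * tau <= t) ->
  x k.+1 = x k + t *: d1 -> y k.+1 = y k + t *: d2 ->
  Phi G H (x k.+1) (y k.+1) <=
    Phi G H (x k) (y k) - alpha * Num.min beta (rho * tau) * eta.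
Proof.
move=> d1 d2 D t tau0 eta0 D_le arm t_ge -> ->; apply: le_trans arm _.
have /andP[a0 _] := alpha01; have /andP[r0 _] := rho01.
have t0 : 0 <= t by rewrite mulr_ge0 ?exprn_ge0 ?ltW.
have min_t : Num.min beta (rho * tau) <= t.
  rewrite ge_min; case: t_ge => [l0|->]; last by rewrite orbT.
  by rewrite /t l0 expr0 mulr1 lexx.
rewrite -/D lerD2l -!(mulrA alpha) -mulrN ler_pM2l // -mulrN.
apply: le_trans (ler_wpM2l t0 D_le) _; rewrite !mulrN lerN2.
by rewrite ler_wpM2r.
Qed.

Lemma srpl_nonincreasing k :
  Phi G H (x k.+1) (y k.+1) <= Phi G H (x k) (y k).
Proof.
have [xt [yt [l [[min1 min2 _] [arm _ x1 y1]]]]] := xy_srpl k.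
have [Dx Dy] := Dxy k.
(* With both thresholds 0 the guaranteed drop is 0, which leaves plain monotonicity. *)
have /= := srpl_decrease_at 0 0 k xt yt l; rewrite !mulr0 subr0; apply=> //.
  rewrite oppr0 mulr_le0_ge0 ?invr_ge0 ?mulr_ge0 // -[0](addr0 0) lerD //.
    exact: (minimizer_L1_le0 G H mu1 (x k) (y k) xt mu1_ge0 (Gx_neq0 _ Dx) Dx min1).
  rewrite L2E; apply: (minimizer_L1_le0 H G mu2 (y k) (x k) yt) => //.
    exact: Hy_neq0.
  by move: min2; rewrite (_ : L2 G H (x k) (y k) = L1 H G (y k) (x k)) //;
    apply/funext => v; rewrite L2E.
by right; have /andP[r0 _] := rho01; rewrite mulr_ge0 ?exprn_ge0 ?ltW.
Qed.

(* Were the regularized linear model to decrease at the accumulation point, the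
   steps near it would be bounded away from 0 and [Phi] would drop by a fixed
   amount infinitely often. *)
Lemma cluster_model_ge0 (xbar : X) (ybar : Y) u :
  cluster ((fun k => (x k, y k)) @ \oo) (xbar, ybar) ->
  spectraplex X xbar -> spectraplex Y ybar -> spectraplex X u ->
  0 <= L1 G H xbar ybar u + mu1 / 2 * `|u - xbar| ^+ 2.
Proof.
move=> xy_cluster Dxbar Dybar Du; rewrite leNgt; apply/negP => model_lt0.
pose F := fun z : X * Y => L1 G H z.1 z.2 u + mu1 / 2 * `|u - z.1| ^+ 2.
pose eps := - F (xbar, ybar) / 2.
have eps0 : 0 < eps by rewrite divr_gt0 // oppr_gt0.
have F_cvg : F @ nbhs (xbar, ybar) --> F (xbar, ybar).
  apply: cvgD; first by apply: L1_cvg; exact: Gx_neq0.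
  apply: cvgM; first exact: cvg_cst.
  have uB : (fun z : X * Y => `|u - z.1|) @ nbhs (xbar, ybar) --> `|u - xbar|.
    by apply: cvg_norm; apply: cvgB; [exact: cvg_cst | exact: cvg_fst].
  by rewrite expr2; apply: cvgM.
have nG_cvg : (fun z : X * Y => `|G z.1|) @ nbhs (xbar, ybar) --> `|G xbar|.
  by apply: cvg_norm; apply: linear_cvg; exact: cvg_fst.
have nH_cvg : (fun z : X * Y => `|H z.2|) @ nbhs (xbar, ybar) --> `|H ybar|.
  by apply: cvg_norm; apply: linear_cvg; exact: cvg_snd.
have Gxbar0 : 0 < `|G xbar| by rewrite normr_gt0; exact/eqP/Gx_neq0.
have Hybar0 : 0 < `|H ybar| by rewrite normr_gt0; exact/eqP/Hy_neq0.
pose m := Num.min (`|G xbar| / 2) (`|H ybar| / 2).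
have m0 : 0 < m by rewrite lt_min !divr_gt0.
have m_lt a : 0 < a -> m <= a / 2 -> m < a by move=> a0 ma; apply: le_lt_trans ma _; lra.
(* Three open conditions valid at the limit: the model is below half its negative value, and the
   norms stay above half theirs. *)
have good : \forall z \near (xbar, ybar),
    [/\ F z < - eps, m < `|G z.1| & m < `|H z.2|].
  near=> z; split; near: z.
  - by apply: (cvgr_lt _ F_cvg); move: eps0; rewrite /eps; lra.
  - by apply: (cvgr_gt _ nG_cvg); apply: m_lt => //; rewrite ge_min lexx.
  - by apply: (cvgr_gt _ nH_cvg); apply: m_lt => //; rewrite ge_min lexx orbT.
have [CG CG0 GC] := linear_norm_le G; have [CH CH0 HC] := linear_norm_le H.
have [MX MX0 DX] := spectraplex_bounded scX.
have [MY MY0 DY] := spectraplex_bounded scY.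
pose M := CG * MX + CH * MY.
have M0 : 0 < M by rewrite addr_gt0 // mulr_gt0.
have G_le v : spectraplex X v -> `|G v| <= M.
  move=> /DX vM; apply: le_trans (GC _) _.
  by apply: ler_wpDr; [rewrite mulr_ge0 ?ltW | rewrite ler_pM2l].
have H_le v : spectraplex Y v -> `|H v| <= M.
  move=> /DY vM; apply: le_trans (HC _) _.
  by apply: ler_wpDl; [rewrite mulr_ge0 ?ltW | rewrite ler_pM2l].
(* The descent is divided by the product of the two norms, which is at most [M * M]. *)
pose eta := eps / (M * M).
have eta0 : 0 < eta by rewrite divr_gt0 // mulr_gt0.
have [tau tau0 tau_armijo] :
  exists2 tau : R, 0 < tau & forall a b d (e : Y) (t : R),
    m <= `|G a| -> m <= `|H b| -> `|G d| <= 2 * M -> `|H e| <= 2 * M ->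
    (L1 G H a b d + L2 G H a b e) / (`|G a| * `|H b|) <= - eta ->
    0 < t <= tau -> armijo G H alpha a b d e t.
  by apply: armijo_small => //; exact: mulr_gt0.
have /andP[a0 _] := alpha01; have /andP[r0 _] := rho01.
pose c := alpha * Num.min beta (rho * tau) * eta.
have c0 : 0 < c.
  apply: mulr_gt0 => //; apply: mulr_gt0 => //.
  by rewrite lt_min beta0 mulr_gt0.
have [N|k] := frequent_decrease_unbounded
    (fun k => Phi G H (x k) (y k)) c (-1) c0 srpl_nonincreasing; last first.
  by rewrite ltNge cosine_ge.
have [_ [[k Nk <-] [Fk mGk mHk]]] :
    [set (x k, y k) | k in [set k | (N <= k)%N]] `&`
    [set z | [/\ F z < - eps, m < `|G z.1| & m < `|H z.2|]] !=set0.
  apply: xy_cluster => //.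
  by exists N => // k Nk; exists k.
exists k => //.
have [xt [yt [l [[min1 min2 _] [arm not_arm x1 y1]]]]] := xy_srpl k.
have [Dx Dy] := Dxy k.
have L1_le : L1 G H (x k) (y k) (xt - x k) <= - eps.
  exact: le_trans (minimizer_L1_le G H mu1 _ _ u _ mu1_ge0 (Gx_neq0 _ Dx) min1 Du) (ltW Fk).
have L2_le : L2 G H (x k) (y k) (yt - y k) <= 0.
  rewrite L2E; apply: (minimizer_L1_le0 H G mu2 (y k) (x k) yt) => //.
    exact: Hy_neq0.
  by move: min2; rewrite (_ : L2 G H (x k) (y k) = L1 H G (y k) (x k)) //;
    apply/funext => v; rewrite L2E.
have D_le : (L1 G H (x k) (y k) (xt - x k) + L2 G H (x k) (y k) (yt - y k)) /
    (`|G (x k)| * `|H (y k)|) <= - eta.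
  have GH0 : 0 < `|G (x k)| * `|H (y k)| by rewrite mulr_gt0 // (lt_trans m0).
  rewrite ler_pdivrMr //; apply: le_trans (_ : - eps <= _); first by lra.
  rewrite mulNr lerN2 /eta mulrAC ler_pdivrMr ?mulr_gt0 // ler_pM2l //.
  by rewrite ler_pM // ?G_le ?H_le.
apply: srpl_decrease_at x1 y1 => //; try exact: ltW.
(* After backtracking, the previous trial step was rejected, hence exceeded [tau]; the accepted one
   is [rho] times it. *)
case: l arm not_arm => [|l] arm not_arm; [by left|right].
rewrite exprS mulrCA ler_pM2l // leNgt; apply/negP => t_lt.
apply: (not_arm l) => //; case: min1 => Dxt _; case: min2 => Dyt _.
apply: tau_armijo => //; try exact: ltW.
- rewrite linearB; apply: le_trans (ler_normB _ _) _.
  by have := G_le _ Dxt; have := G_le _ Dx; lra.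
- rewrite linearB; apply: le_trans (ler_normB _ _) _.
  by have := H_le _ Dyt; have := H_le _ Dy; lra.
- by rewrite mulr_gt0 ?exprn_gt0 //= ltW.
Unshelve. all: by end_near. Qed.

Lemma cluster_feasible (xbar : X) (ybar : Y) :
  cluster ((fun k => (x k, y k)) @ \oo) (xbar, ybar) ->
  spectraplex X xbar /\ spectraplex Y ybar.
Proof.
move=> xy_cluster.
have near_seq (B : set (X * Y)) : nbhs (xbar, ybar) B -> exists k, B (x k, y k).
  move=> nB; have [|_ [[k _ <-] Bk]] :=
      xy_cluster (range (fun k => (x k, y k))) B _ nB; last by exists k.
  by exists 0%N => // k _; exists k.
split.
- apply: (spectraplex_closed scX) => B nB.
  have [|k Bk] := near_seq (fst @^-1` B); first exact: cvg_fst.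
  by exists (x k); split=> //; case: (Dxy k).
- apply: (spectraplex_closed scY) => B nB.
  have [|k Bk] := near_seq (snd @^-1` B); first exact: cvg_snd.
  by exists (y k); split=> //; case: (Dxy k).
Qed.

(** Rescaling reduces the cone to the spectraplex. Along a segment from [xbar], [L1] is linear and
    the regularization quadratic, so a negative slope would make the model negative nearby. *)
Lemma cluster_L1_ge0 (xbar : X) (ybar : Y) u :
  cluster ((fun k => (x k, y k)) @ \oo) (xbar, ybar) ->
  symmetric_cone X u -> 0 <= L1 G H xbar ybar u.
Proof.
move=> xy_cluster Ku; have [Dxbar Dybar] := cluster_feasible _ _ xy_cluster.
have L1xbar : L1 G H xbar ybar xbar = 0 by apply: L1_self; exact: Gx_neq0.
suff L1_ge0 v : spectraplex X v -> 0 <= L1 G H xbar ybar v.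
  have [->|/eqP u0] := eqVneq u 0; first by rewrite /L1 linear0 inner0l.
  have e0 := inner_one_cone_gt0 _ Ku u0.
  rewrite -(@pmulr_rge0 _ (inner jone u)^-1) ?invr_gt0 // -L1Z.
  apply: L1_ge0; split; last by rewrite innerZr mulVf // gt_eqF.
  by apply: symmetric_coneZ => //; rewrite invr_ge0 ltW.
move=> Dv; rewrite leNgt; apply/negP => L1_lt0.
set l := L1 _ _ _ _ _ in L1_lt0; pose n := mu1 / 2 * `|v - xbar| ^+ 2.
have n0 : 0 <= n by rewrite mulr_ge0 ?divr_ge0 ?sqr_ge0.
have nl0 : 0 < n - l by lra.
(* The model at parameter [s] is [s * (l + s * n)]; this choice gives [l + s * n = s * l], which is
   negative, and [n >= 0] gives [s <= 1]. *)
pose s := - l / (n - l).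
have s01 : 0 < s <= 1 by rewrite divr_gt0 ?oppr_gt0 //= ler_pdivrMr //; lra.
have /andP[s0 s1] := s01.
have Ds : spectraplex X (xbar + s *: (v - xbar)).
  by apply: spectraplex_segment => //; rewrite ltW.
have := cluster_model_ge0 _ _ _ xy_cluster Dxbar Dybar Ds.
rewrite [X in `|X|](_ : _ = s *: (v - xbar)); last by rewrite [LHS]addrC addKr.
rewrite L1D L1Z L1B L1xbar subr0 add0r normrZ (gtr0_norm s0).
rewrite [X in 0 <= X](_ : _ = s * (l + s * n)) ?pmulr_rge0 //; last first.
  by rewrite /l /n; ring.
have sE : s * (n - l) = - l by rewrite divfK // gt_eqF.
have : s * l < 0 by rewrite pmulr_rlt0.
by lra.
Qed.

Lemma cluster_stationary (xbar : X) (ybar : Y) :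
  cluster ((fun k => (x k, y k)) @ \oo) (xbar, ybar) ->
  exists gx : X, [/\ is_gradient (fun u => Phi G H u ybar) xbar gx,
    dual_cone (symmetric_cone X) gx & inner xbar gx = 0].
Proof.
move=> xy_cluster; have [Dxbar Dybar] := cluster_feasible _ _ xy_cluster.
have Gx0 := Gx_neq0 _ Dxbar; have Hy0 := Hy_neq0 _ Dybar.
have [gx gxE] : exists gx : X, forall u,
    L1 G H xbar ybar u / (`|G xbar| * `|H ybar|) = inner gx u.
  by apply: riesz => a u v; rewrite L1D L1Z mulrDl mulrA.
exists gx; split; last first.
- by rewrite innerC -gxE L1_self // mul0r.
- move=> u Ku; rewrite -gxE divr_ge0 ?mulr_ge0 //.
  exact: cluster_L1_ge0.
have [C C0 GC] := linear_norm_le G.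
have Gn : 0 < `|G xbar| by rewrite normr_gt0; exact/eqP.
(* The radius forces the norm of [G h] below half that of [G xbar]; the constant comes from
   [cosine_taylor] with zero increment in the second argument. *)
apply: (is_gradient_quadratic _ _ _ (`|G xbar| / (2 * C)) (18 * (C / `|G xbar|) ^+ 2)).
  by rewrite divr_gt0 // mulr_gt0.
move=> h; rewrite ltr_pdivlMr ?mulr_gt0 // => h_lt.
have Gh := GC h.
have Gh2 : `|G h| <= `|G xbar| / 2 by lra.
have H02 : `|0 : V| <= `|H ybar| / 2 by rewrite normr0 divr_ge0.
have := cosine_taylor _ _ _ _ Gx0 Hy0 Gh2 H02.
rewrite -gxE L1_dcosine !PhiE (linearD G) addr0.
have -> : dcosine (H ybar) (G xbar) 0 = 0.
  by rewrite /dcosine inner0l inner0r mulr0 subr0 mul0r.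
rewrite addr0 normr0 mul0r expr0n addr0 => /le_trans; apply.
rewrite -mulrA ler_pM2l // -exprMn ler_sqr ?nnegrE ?divr_ge0 ?mulr_ge0 ?(ltW C0) //.
by rewrite mulrAC ler_pM2r ?invr_gt0.
Qed.

End Convergence.

(** * Exchange of the two blocks and stationarity of the pair *)

Lemma is_gradient_affine {R : realType} {V : euclideanType R} (g u : V) (b : R) :
  is_gradient (fun v => inner g v - b) u g.
Proof.
apply: (is_gradient_quadratic _ _ _ 1 0) => // h _.
by rewrite mul0r innerDr [X in `|X|](_ : _ = 0) ?normr0 //; ring.
Qed.

(** The algorithm treats both blocks alike, so the conditions in [y] are those in [x] for the
    exchanged data. *)
Lemma srpl_sequence_swap {R : realType} {V : euclideanType R} {X Y : ejaType R}
    (G : {linear X -> V}) (H : {linear Y -> V}) (alpha beta rho mu1 mu2 : R)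
    (x : nat -> X) (y : nat -> Y) :
  srpl_sequence G H alpha beta rho mu1 mu2 x y ->
  srpl_sequence H G alpha beta rho mu2 mu1 y x.
Proof.
move=> xy k; have [xt [yt [l [[min1 min2 stop] [arm not_arm x1 y1]]]]] := xy k.
have L2f : L2 G H (x k) (y k) = L1 H G (y k) (x k) by apply/funext => v; exact: L2E.
have L1f : L2 H G (y k) (x k) = L1 G H (x k) (y k) by apply/funext => v; exact: L2E.
have armE d e t :
    armijo H G alpha (y k) (x k) e d t = armijo G H alpha (x k) (y k) d e t.
  by rewrite /armijo !(Phi_swap H G) L1f L2f (addrC (L1 H G _ _ _)) (mulrC `|H _|).
exists yt, xt, l; rewrite L1f -L2f; split; split=> //.
- by move=> [? ?]; apply: stop.
- by rewrite armE.
- by move=> l' /not_arm; rewrite armE.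
Qed.

Theorem theorem4 (R : realType) (V : euclideanType R) (X Y : ejaType R)
    (G : {linear X -> V}) (H : {linear Y -> V}) (P Q : set V)
    (alpha beta rho mu1 mu2 : R) (x : nat -> X) (y : nat -> Y)
    (hX : scalarizable X) (hY : scalarizable Y)
    (hP : lisc_representation G P) (hQ : lisc_representation H Q)
    (hPC : nontrivial_cone P) (hQC : nontrivial_cone Q)
    (hx0 : spectraplex X (x 0%N)) (hy0 : spectraplex Y (y 0%N))
    (hbeta : 0 < beta) (halpha : 0 < alpha < 1) (hrho : 0 < rho < 1)
    (hmu1 : 0 <= mu1) (hmu2 : 0 <= mu2)
    (hxy : srpl_sequence G H alpha beta rho mu1 mu2 x y)
    (hfeas : 1 < beta ->
      forall k, spectraplex X (x k) /\ spectraplex Y (y k)) :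
  forall (xbar : X) (ybar : Y),
    cluster ((fun k => (x k, y k)) @ \oo) (xbar, ybar) ->
    fp_stationary G H xbar ybar.
Proof.
(* Steps longer than 1 may leave the spectraplexes; in that range feasibility is supplied by
   [hfeas]. *)
have Dxy k : spectraplex X (x k) /\ spectraplex Y (y k).
  have [/hfeas Dxy|beta1] := ltP 1 beta; first exact: Dxy.
  exact: (srpl_feasible hX hY hbeta hrho hxy k hx0 hy0 beta1).
move=> xbar ybar xy_cluster.
have yx_cluster : cluster ((fun k => (y k, x k)) @ \oo) (ybar, xbar).
  move=> A B FA nB.
  have [||[a b] [Aba Bba]] :=
      xy_cluster ((fun z => (z.2, z.1)) @^-1` A) ((fun z => (z.2, z.1)) @^-1` B).
  - exact: FA.
  - exact: (@swap_continuous X Y (xbar, ybar) B nB).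
  by exists (b, a).
have Dyx k : spectraplex Y (y k) /\ spectraplex X (x k) by case: (Dxy k).
have [gx [dgx gxK gx0]] :=
  cluster_stationary hX hY hP hQ halpha hbeta hrho hmu1 hmu2 hxy Dxy _ _ xy_cluster.
have [gy [dgy gyK gy0]] :=
  cluster_stationary hY hX hQ hP halpha hbeta hrho hmu2 hmu1
    (srpl_sequence_swap _ _ _ _ _ _ _ _ _ hxy) Dyx _ _ yx_cluster.
have [[Kx ex] [Ky ey]] := cluster_feasible hX hY Dxy _ _ xy_cluster.
(* Both multipliers are zero, and [jone] is the gradient of each normalization constraint. *)
exists 0, 0, gx, jone, gy, jone; rewrite !scale0r !addr0 ex ey subrr.
split; last by [].
split; [exact: dgx|exact: is_gradient_affine| |exact: is_gradient_affine].
by rewrite (_ : (fun v => _) = fun v => Phi H G v xbar) //;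
  apply/funext => v; exact: Phi_swap.
Qed.
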